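(* Let $n\ge3$. (i) If $2\le i<j\le n$ and $j>i+1$, then $$\begin{aligned} B_n\,P\big((i,j)\in\mathcal V_n^w\setminus\mathcal V_n\big)&=\sum_{t=1}^{i-1}S_{i-1,t}\,\Theta_{n-j}(t)\big\{-t^{j-i}+t^{j-i-1}+2\Psi_{j-i}(t-1)\big\}\\ &\quad+\sum_{t=1}^{i-1}S_{i-1,t}\,\Theta_{n-j+1}(t)\,t^{j-i-1}\\ &\quad-\sum_{t=1}^{i-1}S_{i-1,t}\,\Theta_{n-j}(t+1)\big\{-(t+1)t^{j-i-1}+t(t+1)^{j-i-1}\big\}\\ &\quad+\sum_{t=1}^{i-1}S_{i-1,t}\,\Theta_{n-j+1}(t+1)\big\{(t+1)^{j-i-1}-t^{j-i-1}\big\}. \end{aligned}$$ (ii) If $i=1$ and $3\le j\le n$, then $$P\big((i,j)\in\mathcal V_n^w\setminus\mathcal V_n\big)=\frac{B_{n-j+i+1}}{B_n}.$$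
   Context: A restricted growth sequence of length $n$ is a sequence $\pi=\pi_1\cdots\pi_n$ of positive integers with $\pi_1=1$ and $\pi_{j+1}\le 1+\max\{\pi_1,\dots,\pi_j\}$ for $1\le j<n$. $\mathcal R_n$ is the set of all of them; its cardinality is the Bell number $B_n$. $\pi^{(n)}$ denotes a uniformly random element of $\mathcal R_n$. For a sequence $\pi$, a pair $(i,j)$ with $1\le i<j\le n$ is a strong visible pair if $\max_{i<\ell<j}\pi_\ell<\min\{\pi_i,\pi_j\}$, and a weak visible pair if $\max_{i<\ell<j}\pi_\ell\le\min\{\pi_i,\pi_j\}$ (with $\max\emptyset=-\infty$). $\mathcal V_\pi$ and $\mathcal V^w_\pi$ are the sets of strong and weak visible pairs of $\pi$; write $\mathcal V_n:=\mathcal V_{\pi^{(n)}}$ and $\mathcal V_n^w:=\mathcal V^w_{\pi^{(n)}}$. $S_{n,k}$ are the Stirling numbers of the second kind and $B_n=\sum_{k=0}^nS_{n,k}$ the Bell numbers. For integers $n,t\ge0$, $$\Theta_n(t):=\frac1e\sum_{m=t}^\infty\frac{m^n}{(m-t)!}=\sum_{\ell=0}^n\binom n\ell t^{n-\ell}B_\ell .$$ For $n\in\mathbb N$, $t\ge0$, $\Psi_n(t):=\sum_{k=0}^t k^{n-1}$. *)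

(* Defs.v *)
From mathcomp Require Import all_boot all_order all_algebra.
From mathcomp Require Import all_classical all_reals all_analysis.

Set Implicit Arguments.
Unset Strict Implicit.
Unset Printing Implicit Defensive.

Import Order.TTheory GRing.Theory Num.Theory.
Import numFieldNormedType.Exports.

(** Sequences are indexed from 1: [term s j] is s_j for 1 <= j <= size s. *)
Definition term (s : seq nat) (j : nat) : nat := nth 0 s j.-1.

Definition restricted_growth (s : seq nat) : bool :=
  [&& all (fun x => 0 < x) s,
      (0 < size s) ==> (term s 1 == 1)
    & all (fun j => term s j.+1 <= 1 + \max_(1 <= l < j.+1) term s l)
          (index_iota 1 (size s))].

(** The entries of a restricted growth sequence of length n are at most n, so
    'I_n.+1 is a large enough alphabet; see [RG_complete] below. *)
Definition word (n : nat) (p : n.-tuple 'I_n.+1) : seq nat :=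
  [seq nat_of_ord x | x <- p].

Definition RG (n : nat) : {set n.-tuple 'I_n.+1} :=
  [set p | restricted_growth (word p)].

Lemma restricted_growth_term s j :
  restricted_growth s -> 0 < j <= size s -> term s j <= j.
Proof.
move=> /and3P[_ s1 /allP sS]; elim/ltn_ind: j => -[//|[|j]] IH /= js.
  by move: s1; rewrite js implyTb => /eqP ->.
apply: leq_trans (sS j.+1 _) _; first by rewrite mem_index_iota.
rewrite add1n ltnS big_nat_cond; apply/bigmax_leqP_seq => l _.
rewrite andbT => /andP[l0 lj]; apply: leq_trans (IH l lj _) _; last by [].
by rewrite l0 (leq_trans (ltnW lj) js).
Qed.

Lemma word_inj n : injective (@word n).
Proof. by move=> p q /(inj_map val_inj)/val_inj. Qed.

Lemma RG_complete n (s : seq nat) :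
  (size s == n) && restricted_growth s <-> exists2 p, p \in RG n & word p = s.
Proof.
split=> [/andP[/eqP ns rs]|[p]]; last first.
  by rewrite inE => rp <-; rewrite rp size_map size_tuple eqxx.
have ts : size [seq (inord x : 'I_n.+1) | x <- s] == n by rewrite size_map ns.
have es : word (Tuple ts) = s.
  rewrite /word /= -map_comp -[RHS]map_id; apply/eq_in_map => x xs /=.
  rewrite inordK // ltnS -(nth_index 0 xs).
  have xi : index x s < size s by rewrite index_mem.
  by apply: leq_trans (restricted_growth_term (j := (index x s).+1) rs _) _;
    rewrite -?ns.
by exists (Tuple ts); rewrite // inE es.
Qed.

(** The empty [\max] is 0 instead of -oo: on sequences of positive integers
    this makes no difference, both conditions hold when j = i + 1. *)
Definition strong_visible (s : seq nat) : {pred nat * nat} :=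
  [pred ij | [&& 1 <= ij.1, ij.1 < ij.2, ij.2 <= size s
    & \max_(ij.1.+1 <= l < ij.2) term s l < minn (term s ij.1) (term s ij.2)]].

Definition weak_visible (s : seq nat) : {pred nat * nat} :=
  [pred ij | [&& 1 <= ij.1, ij.1 < ij.2, ij.2 <= size s
    & \max_(ij.1.+1 <= l < ij.2) term s l <= minn (term s ij.1) (term s ij.2)]].

Definition stirling2 (n k : nat) : nat :=
  #|[set P : {set {set 'I_n}} | finset.partition P [set: 'I_n] & #|P| == k]|.

Definition bell (n : nat) : nat := \sum_(0 <= k < n.+1) stirling2 n k.

(** For n >= 1 only, since the exponent is n - 1. *)
Definition Psi (n t : nat) : nat := \sum_(0 <= k < t.+1) k ^ n.-1.

Local Open Scope ring_scope.

Definition unif_prob (R : realType) (T : finType) (A : {set T})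
    (E : pred T) : R :=
  #|[set x in A | E x]|%:R / #|A|%:R.

(** The series converges for all n and t; 0 ^+ 0 = 1, so that Theta 0 0 = 1. *)
Definition Theta (R : realType) (n t : nat) : R :=
  (expR 1)^-1 *
    limn (fun N => \sum_(t <= m < N) (m%:R ^+ n / ((m - t)`!)%:R : R)).

(* Main.v *)
Require Import Defs.
From mathcomp Require Import all_boot all_order all_algebra.
From mathcomp Require Import all_classical all_reals all_analysis.
From mathcomp Require Import zify ring.
Import Order.TTheory GRing.Theory Num.Theory.
Import numFieldNormedType.Exports.

(** Everything is driven by one operator on functions of the current maximum.
    A sequence whose maximum is [t] has [t] continuations by one letter that
    keep the maximum, and one that raises it to [t + 1].  Hence, if [F s] counts
    some kind of continuation of a sequence with maximum [s], then [grow F t]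
    counts those that come after one more, unconstrained, letter.  The
    ingredients of the formula are all iterates of [grow]:
    - the sum of [S_{m,k} F k] over [k] is [grow^m F 0] ([sum_stirling2]),
      because a new point joins one of the [k] blocks of a set partition or
      forms a block of its own;
    - [Theta_m t] is [grow^m 1 t] ([ThetaE]), because the terms of its series
      satisfy the same recurrence, from [m = t + (m - t)]; thus [Theta_m t] is
      the number of ways to append [m] letters at maximum [t], and [B_n] is its
      value at [t = 0].

    A pair [(i, j)] is weakly but not strongly visible exactly when the maximum
    of the letters strictly between equals the smaller end.  The
    [i - 1] letters before position [i] matter only through their maximum [t],
    so the number of favourable sequences is [grow^(i-1) G 0], where [G t] counts
    the continuations from position [i] on ([card_touching_RG]); this is the sum
    of [S_{i-1,t} G t].  There remains a count at a fixed [t].  Put [d = j-i-1]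
    and [r = n-j], and fix the letter [a] at position [i].  If the middle letters
    have maximum [a], which happens in [a^d - (a-1)^d] ways, then the letter at
    [j] is any letter not below [a]; if their maximum is less than [a], which
    happens in [(a-1)^d] ways, then the letter at [j] must equal it.  Summing
    over [a <= t] by parts produces the power sum [Psi], and the record letter
    [a = t + 1] gives the remaining terms ([touching_growthsE]).  The recurrence
    [Theta_{r+1} t = t * Theta_r t + Theta_r (t + 1)] turns the result into the
    stated combination.  For [i = 1] only [t = 0] and [a = 1] occur, and the
    count collapses to [B_{r+2}] ([touching_growths0]). *)

(** * Set partitions and Stirling numbers *)

Definition grow (F : nat -> nat) (t : nat) : nat := t * F t + F t.+1.

Section SetPartitions.
Variable T : finType.
Implicit Types (A B : {set T}) (P Q : {set {set T}}).

(** A partition of [x |: A] is the same thing as a partition [Q] of [A] with a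
    choice of the block [B] of [Q] that [x] joins; [B = set0] stands for the
    case in which [x] is a block by itself.  The next two maps are the two
    directions of this bijection. *)
Definition insert_point (x : T) (QB : {set {set T}} * {set T}) : {set {set T}} :=
  (x |: QB.2) |: (QB.1 :\ QB.2).

Definition delete_point (x : T) (P : {set {set T}}) : {set {set T}} * {set T} :=
  let B := finset.pblock P x in
  ((if B == [set x] then P :\ B else (B :\ x) |: (P :\ B)), B :\ x).

Definition blocked_partition A (QB : {set {set T}} * {set T}) : bool :=
  finset.partition QB.1 A && (QB.2 \in finset.set0 |: QB.1).

(** The block [B] is split off from [Q], enlarged by [x] and put back, which
    reduces the claim to the stability of partitions under removing and adding
    a block. *)
Lemma insert_point_partition x A QB : x \notin A ->
  blocked_partition A QB -> finset.partition (insert_point x QB) (x |: A).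
Proof.
case: QB => Q B xA /andP[/= QA]; rewrite in_setU1 => BQ.
have sBA : B \subset A.
  case/orP: BQ => [/eqP->|BQ]; first exact: finset.sub0set.
  by rewrite -(cover_partition QA) (bigcup_max B).
have QBA : finset.partition (Q :\ B) (A :\: B).
  case/orP: BQ => [/eqP->|BQ]; last exact: partitionD1.
  rewrite finset.setD0 (_ : Q :\ _ = Q) //; apply/setP => C.
  rewrite in_setD1; case: eqVneq => // ->.
  by rewrite (partition0 QA).
rewrite /insert_point /= (_ : x |: A = (x |: B) :|: (A :\: B)); last first.
  by rewrite -finset.setUA -[in LHS](setID A B) (finset.setIidPr sBA).
apply: partitionU1 => //.
  by apply/set0Pn; exists x; rewrite setU11.
rewrite disjoint_sym finset.disjoints_subset; apply/fintype.subsetP => y.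
rewrite !inE negb_or => /andP[-> yA]; rewrite andbT.
by apply: contraNneq xA => <-.
Qed.

Lemma insert_pointK x A QB : x \notin A ->
  blocked_partition A QB -> delete_point x (insert_point x QB) = QB.
Proof.
move=> xA gQB; have part := insert_point_partition _ _ _ xA gQB.
case: QB gQB part => Q B /andP[/= QA]; rewrite in_setU1 => BQ part.
have xnB C : C \in Q -> x \notin C.
  move=> CQ; apply: contra xA => xC.
  by rewrite -(cover_partition QA); apply/bigcupP; exists C.
have xB : x \notin B by case/orP: BQ => [/eqP->|/xnB//]; rewrite finset.in_set0.
rewrite /delete_point.
have -> : finset.pblock (insert_point x (Q, B)) x = x |: B.
  case/and3P: part => _ tI _.
  by apply: def_pblock tI _ _; rewrite !inE eqxx.
rewrite /insert_point /= (setU1K xB).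
have -> : ((x |: B) |: (Q :\ B)) :\ (x |: B) = Q :\ B.
  rewrite setU1K // in_setD1 negb_and; apply/orP; right.
  by apply/negP => /xnB; rewrite setU11.
congr pair; case/orP: BQ => [/eqP B0|BQ].
  rewrite B0 finset.setU0 eqxx; apply/setP => C.
  by rewrite in_setD1; case: eqVneq => // ->; rewrite (partition0 QA).
case: eqP => [e|_]; last exact: finset.setD1K.
have B0 : B = finset.set0.
  apply/setP => y; rewrite finset.in_set0; apply/negP => yB.
  have := setU1r x yB; rewrite e finset.in_set1 => /eqP yx.
  by move: xB; rewrite -yx yB.
by rewrite B0 (partition0 QA) in BQ.
Qed.

Lemma delete_point_partition x A P : x \notin A ->
  finset.partition P (x |: A) -> blocked_partition A (delete_point x P).
Proof.
move=> xA PA; rewrite /blocked_partition /delete_point /=.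
set B := finset.pblock P x.
have xc : x \in finset.cover P by rewrite (cover_partition PA) setU11.
have BP : B \in P by exact: pblock_mem.
have xB : x \in B by rewrite mem_pblock.
have PBA := partitionD1 PA BP.
have sBA : B :\ x \subset A.
  by rewrite subDset -(cover_partition PA) (bigcup_max B).
case: ifPn => Bx; rewrite !inE.
  move: PBA; rewrite (eqP Bx) setU1K // => ->.
  by rewrite finset.setDv eqxx.
rewrite eqxx orbT andbT (_ : A = (B :\ x) :|: ((x |: A) :\: B)); last first.
  rewrite -[in LHS](setID A (B :\ x)) (finset.setIidPr sBA); congr (_ :|: _).
  apply/setP => y; rewrite !inE; case: eqVneq => [->|//].
  by rewrite xB (negPf xA).
apply: partitionU1 => //; last first.
  rewrite disjoint_sym finset.disjoints_subset; apply/fintype.subsetP => y.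
  by rewrite !inE negb_and => /andP[-> _]; rewrite orbT.
apply: contraNneq Bx => Bx0; rewrite finset.eqEsubset finset.sub1set xB andbT.
by rewrite -finset.setD_eq0 Bx0.
Qed.

Lemma delete_pointK x A P :
  finset.partition P (x |: A) -> insert_point x (delete_point x P) = P.
Proof.
move=> PA; rewrite /insert_point /delete_point /=.
set B := finset.pblock P x.
have xc : x \in finset.cover P by rewrite (cover_partition PA) setU11.
have BP : B \in P by exact: pblock_mem.
have xB : x \in B by rewrite mem_pblock.
rewrite (finset.setD1K xB).
suff -> : (if B == [set x] then P :\ B else B :\ x |: P :\ B) :\ (B :\ x)
          = P :\ B by exact: finset.setD1K.
case: eqP => [Bx|Bx].
  have -> : B :\ x = finset.set0 by rewrite Bx finset.setDv.
  apply/setP => C.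
  rewrite in_setD1; case: eqVneq => // ->.
  by rewrite in_setD1 (partition0 PA) andbF.
rewrite setU1K // in_setD1 negb_and; apply/orP; right.
apply/negP => BxP; apply: Bx; apply/eqP;
  rewrite finset.eqEsubset finset.sub1set xB andbT.
apply/fintype.subsetP => y yB; rewrite finset.in_set1; apply: contraT => yx.
have tI := partition_trivIset PA.
have yBx : y \in B :\ x by rewrite in_setD1 yx.
have e : B = B :\ x.
  by rewrite -[LHS](def_pblock tI BP yB) (def_pblock tI BxP yBx).
by move: xB; rewrite e setD11.
Qed.

Lemma card_insert_point x A QB : x \notin A -> blocked_partition A QB ->
  #|insert_point x QB| = #|QB.1| + (QB.2 == finset.set0).
Proof.
case: QB => Q B xA /andP[/= QA]; rewrite in_setU1 => BQ.
rewrite /insert_point /= cardsU1 in_setD1 negb_and.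
have -> : x |: B \notin Q.
  apply: contra xA => xBQ.
  by rewrite -(cover_partition QA); apply/bigcupP; exists (x |: B);
    rewrite ?setU11.
rewrite orbT (cardsD1 B Q); case/orP: BQ => [/eqP->|BQ].
  by rewrite (partition0 QA) eqxx addn1 add1n.
rewrite BQ; case: eqP => [B0|_]; last by rewrite addn0.
by move: BQ; rewrite B0 (partition0 QA).
Qed.

(** Along the bijection the number of blocks changes only when [x] is a block
    by itself, so that each [Q] contributes [#|Q| * F #|Q| + F (#|Q| + 1)]. *)
Lemma sum_partitionU1 (F : nat -> nat) x A : x \notin A ->
  \sum_(P : {set {set T}} | finset.partition P (x |: A)) F #|P| =
  \sum_(Q : {set {set T}} | finset.partition Q A) grow F #|Q|.
Proof.
move=> xA.
rewrite (reindex_onto (insert_point x) (delete_point x)) /=; last first.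
  by move=> P PA; exact: delete_pointK PA.
rewrite (eq_bigl (blocked_partition A)); last first.
  move=> QB; apply/andP/idP => [[QBA /eqP <-]|gQB].
    exact: delete_point_partition.
  by rewrite insert_point_partition // (insert_pointK _ _ _ xA gQB).
rewrite (eq_bigr (fun QB : {set {set T}} * {set T} =>
    F (#|QB.1| + (QB.2 == finset.set0)))); last first.
  by move=> QB gQB; rewrite (card_insert_point _ _ _ xA gQB).
rewrite -(pair_big_dep (fun Q => finset.partition Q A)
           (fun Q B => B \in finset.set0 |: Q)
           (fun Q B => F (#|Q| + (B == finset.set0)))) /=.
apply: eq_bigr => Q QA; rewrite big_setU1 ?(partition0 QA) //= eqxx addn1.
rewrite /grow addnC; congr addn.
rewrite -sum_nat_const; apply: eq_bigr => B BQ.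
case: eqP => [B0|_]; last by rewrite addn0.
by move: BQ; rewrite B0 (partition0 QA).
Qed.

Lemma sum_partition (F : nat -> nat) A :
  \sum_(P : {set {set T}} | finset.partition P A) F #|P| = iter #|A| grow F 0.
Proof.
elim: {A}#|A| {-2}A (erefl #|A|) F => [|m IHm] A cA F.
  rewrite (cards0_eq cA) (big_pred1 finset.set0) ?cards0 // => P.
  exact: partition_set0.
have /card_gt0P[x xA] : 0 < #|A| by rewrite cA.
have xAx : x \notin A :\ x by rewrite setD11.
rewrite -(finset.setD1K xA) (sum_partitionU1 _ _ _ xAx) IHm.
  by rewrite -iterSr cardsU1 xAx.
by apply: succn_inj; rewrite -cA (cardsD1 x A) xA.
Qed.

End SetPartitions.

Lemma card_partition_le (T : finType) (P : {set {set T}}) (A : {set T}) :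
  finset.partition P A -> #|P| <= #|A|.
Proof.
move=> PA; rewrite (card_partition PA) -sum1_card; apply: leq_sum => B BP.
rewrite card_gt0; apply: contraTneq BP => ->.
by rewrite (partition0 PA).
Qed.

(** This form of the Stirling recurrence, with an arbitrary weight [F], is what
    lets a count by prefixes be written as a sum against [S_{m,k}] without a
    bijection between sequences and set partitions. *)
Lemma sum_stirling2 (m : nat) (F : nat -> nat) :
  \sum_(0 <= k < m.+1) stirling2 m k * F k = iter m grow F 0.
Proof.
rewrite -[in RHS](card_ord m) -cardsT -sum_partition big_mkord.
rewrite (partition_big (fun P : {set {set 'I_m}} => inord #|P| : 'I_m.+1)
  xpredT) //=.
apply: eq_bigr => k _; rewrite /stirling2 -sum_nat_const.
apply: eq_big => [P|P /[!inE]/andP[_ /eqP->]] //.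
rewrite inE; case PA: (finset.partition P _) => //=.
have := card_partition_le _ _ _ PA; rewrite cardsT card_ord => Pm.
by rewrite -(inj_eq val_inj) /= inordK.
Qed.

Lemma stirling2_0 (m : nat) : 0 < m -> stirling2 m 0 = 0.
Proof.
move=> m0; apply/eqP; rewrite cards_eq0; apply/eqP/setP => P; rewrite !inE.
apply/negP => /andP[PA]; rewrite cards_eq0 => /eqP P0.
have := cover_partition PA; rewrite P0 /finset.cover big_set0 => /setP.
by move/(_ (Ordinal m0)); rewrite !inE.
Qed.

Lemma bellE (n : nat) : bell n = iter n grow (fun=> 1) 0.
Proof.
by rewrite -sum_stirling2; apply: eq_bigr => k _; rewrite muln1.
Qed.

(** * Continuations of restricted growth sequences *)

(** All the ways to append [m] letters to a restricted growth sequence with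
    maximum [t]; for [t = 0] these are the restricted growth sequences of
    length [m] themselves. *)
Fixpoint growths (m t : nat) : seq (seq nat) :=
  if m is m'.+1 then
    [seq a :: w | a <- iota 1 t.+1, w <- growths m' (maxn t a)]
  else [:: [::]].

Lemma mem_growths m t w :
  (w \in growths m t) = (size w == m) &&
  all (fun j => 0 < nth 0 w j <= (maxn t (\max_(x <- take j w) x)).+1)
      (iota 0 m).
Proof.
elim: m t w => [|m IHm] t [|a w].
- by rewrite mem_seq1.
- by rewrite mem_seq1.
- by apply/allpairsPdep => -[x [y [_ _]]].
have -> : (a :: w \in growths m.+1 t) =
    (0 < a <= t.+1) && (w \in growths m (maxn t a)).
  apply/allpairsPdep/andP => [[x [y [xt yw [-> ->]]]]|[at1 wm]].
    by split=> //; move: xt; rewrite mem_iota; lia.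
  by exists a, w; split=> //; rewrite mem_iota; lia.
rewrite IHm /= eqSS andbCA; congr andb; rewrite big_nil maxn0; congr andb.
rewrite (iotaDl 1 0) all_map; apply: eq_all => j /=.
by rewrite big_cons maxnA.
Qed.

Lemma uniq_growths m t : uniq (growths m t).
Proof.
elim: m t => [//|m IHm] t; apply: allpairs_uniq_dep.
- exact: iota_uniq.
- by move=> ? _; exact: IHm.
- by move=> [x y] [x' y'] _ _ /= [-> ->].
Qed.

(** The letters [a <= t] all lead to the same list of continuations; isolating
    the only record letter [t + 1] is what makes [grow] appear. *)
Lemma count_growthsS m t (Q : pred (seq nat)) :
  count Q (growths m.+1 t) =
  \sum_(1 <= a < t.+1) count (fun w => Q (a :: w)) (growths m t)
  + count (fun w => Q (t.+1 :: w)) (growths m t.+1).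
Proof.
rewrite count_flatten -map_comp sumnE big_map.
rewrite -[iota 1 t.+1]/(index_iota 1 t.+2) big_nat_recr //=.
rewrite count_map (maxn_idPr _) // ; congr addn.
apply: eq_big_nat => a; rewrite ltnS => /andP[_ at1].
by rewrite count_map (maxn_idPl at1).
Qed.

Lemma size_growths m t : size (growths m t) = iter m grow (fun=> 1) t.
Proof.
elim: m t => [//|m IHm] t; rewrite -count_predT count_growthsS /=.
rewrite (eq_bigr (fun=> size (growths m t))) => [|a _]; last exact: count_predT.
rewrite (_ : count _ _ = size (growths m t.+1)); last exact: count_predT.
by rewrite sum_nat_const_nat subn1 /grow -!IHm.
Qed.

(** A property that ignores the first [m] letters sees them only through the
    maximum that they reach. *)
Lemma count_drop_growths m k t (Q : pred (seq nat)) :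
  count (fun w => Q (drop m w)) (growths (m + k) t)
  = iter m grow (fun s => count Q (growths k s)) t.
Proof.
elim: m t => [|m IHm] t.
  by apply: eq_count => w; rewrite drop0.
rewrite addSn count_growthsS /= sum_nat_const_nat subn1 /=.
by rewrite /(grow _ t) -!IHm.
Qed.

Lemma restricted_growthE s : restricted_growth s = (s \in growths (size s) 0).
Proof.
have maxE j : \max_(1 <= l < j.+1) term s l = \max_(x <- take j s) x.
  rewrite big_add1 /= /term.
  have [js|sj] := leqP j (size s).
    rewrite [RHS](big_nth 0) size_takel //.
    by apply: eq_big_nat => l /andP[_ lj]; rewrite nth_take.
  rewrite (big_cat_nat (n := size s)) //=; last exact: ltnW.
  rewrite [X in maxn _ X]big_nat_cond [X in maxn _ X]big1 ?maxn0; last first.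
    by move=> l /andP[/andP[sl _] _]; rewrite nth_default.
  by rewrite [RHS](big_nth 0) take_oversize // ltnW.
rewrite mem_growths eqxx /=.
apply/and3P/allP => [[/allP s0 s1 /allP sS] j|sG].
  rewrite mem_iota add0n => /andP[_ js].
  rewrite s0 ?mem_nth //= max0n.
  case: j js => [|j] js.
    rewrite take0 big_nil; move: s1; rewrite js /= => /eqP s1.
    by rewrite -[nth 0 s 0]/(term s 1) s1.
  rewrite -maxE -add1n; apply: (sS j.+1).
  by rewrite mem_index_iota.
have {}sG j : j < size s -> 0 < nth 0 s j <= (\max_(x <- take j s) x).+1.
  by move=> js; have := sG j; rewrite mem_iota add0n js max0n; apply.
split.
- by apply/(all_nthP 0) => j /sG/andP[].
- apply/implyP => /sG; rewrite take0 big_nil /term /=.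
  by case: (nth 0 s 0) => [|[]].
- apply/allP => j; rewrite mem_index_iota => /andP[j0 js].
  by rewrite maxE add1n; case/andP: (sG _ js).
Qed.

Lemma card_RG (n : nat) (Q : pred (seq nat)) :
  #|[set p in RG n | Q (word p)]| = count Q (growths n 0).
Proof.
rewrite cardE -(size_map (@word n)) -size_filter; apply: perm_size.
apply: uniq_perm.
- by rewrite map_inj_uniq ?enum_uniq //; exact: word_inj.
- by rewrite filter_uniq // uniq_growths.
move=> s; rewrite mem_filter; apply/mapP/andP.
  move=> [p]; rewrite mem_enum inE => /andP[pR Qp] ->; split=> //.
  have szp : size (word p) = n by rewrite size_map size_tuple.
  by rewrite -[n in growths n _]szp -restricted_growthE; move: pR; rewrite inE.
move=> [Qs sG].
have sn : size s = n by move: sG; rewrite mem_growths => /andP[/eqP].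
have [p pR ps] : exists2 p, p \in RG n & word p = s.
  by apply/RG_complete; rewrite sn eqxx restricted_growthE sn.
by exists p; rewrite // mem_enum inE pR ps.
Qed.

(** * Weakly but not strongly visible pairs *)

(** The word starts just after a letter [a]; [M] is an accumulator for the
    maximum of the letters already read, so that the predicate can be followed
    letter by letter. *)
Definition touches (d M a : nat) : pred (seq nat) :=
  fun w => maxn M (\max_(x <- take d w) x) == minn a (nth 0 w d).

(** The two visibility conditions differ only in the case of equality. *)
Lemma weak_not_strong (i d : nat) (s : seq nat) : i + d.+2 <= size s ->
  ((i.+1, i + d.+2) \in [predD weak_visible s & strong_visible s]) =
  touches d 0 (nth 0 (drop i s) 0) (behead (drop i s)).
Proof.
move=> sz; have ij : i.+1 < i + d.+2 by lia.
rewrite !inE /= sz ij /= -leqNgt.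
rewrite /touches max0n -drop1 drop_drop add1n nth_drop addn0 nth_drop /term /=.
have -> : \max_(i.+2 <= l < i + d.+2) nth 0 s l.-1 =
          \max_(x <- take d (drop i.+1 s)) x.
  rewrite [RHS](big_nth 0) size_takel ?size_drop; last by lia.
  rewrite -[i.+2]add0n big_addn (_ : _ - _ = d); last by lia.
  apply: eq_big_nat => l /andP[_ ld]; rewrite nth_take // nth_drop.
  by congr nth; lia.
have -> : (i + d.+2).-1 = i.+1 + d by lia.
by rewrite eqn_leq andbC.
Qed.

Lemma touches_gt d M a w : a < M -> touches d M a w = false.
Proof. by move=> aM; apply/eqP; lia. Qed.

(** The letter [a] is now at most the maximum [t], so that the [d] middle letters
    leave this maximum unchanged whenever they stay below [a].  Here [c] and [c']
    count the continuations by [r] letters at maximum [t] and [t + 1], and [e a]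
    counts the continuations by a letter not below [a] followed by [r] letters:
    there are [t - a + 1] such letters up to [t], and the record [t + 1]. *)
Section Touching.
Variables (r t : nat).

Let c := size (growths r t).
Let c' := size (growths r t.+1).
Let e a := (t - a).+1 * c + c'.

Let K (d M a : nat) := count (touches d M a) (growths (d + r.+1) t).

Lemma count_touches0 M a : K 0 M a =
  (\sum_(1 <= b < t.+1) (M == minn a b)) * c + (M == minn a t.+1) * c'.
Proof.
rewrite /K count_growthsS big_distrl /=; congr addn.
  apply: eq_bigr => b _; rewrite /touches /= big_nil maxn0.
  by case: (_ == _); rewrite ?count_predT ?count_pred0 ?mul1n.
rewrite /touches /= big_nil maxn0.
by case: (_ == _); rewrite ?count_predT ?count_pred0 ?mul1n.
Qed.

(** A middle letter larger than [a] makes the maximum exceed the smaller end for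
    good; in particular a record letter never contributes. *)
Lemma count_touchesS d M a : a <= t ->
  K d.+1 M a = \sum_(1 <= x < a.+1) K d (maxn M x) a.
Proof.
move=> at0; rewrite /K addSn count_growthsS /=.
have tE x w : touches d.+1 M a (x :: w) = touches d (maxn M x) a w.
  by rewrite /touches /= big_cons maxnA.
rewrite (eq_count (a2 := pred0)) => [|w /=]; last first.
  by rewrite tE touches_gt // leq_max ltnS at0 orbT.
rewrite count_pred0 addn0 (big_cat_nat (n := a.+1)) //=.
rewrite [X in _ + X]big_nat_cond [X in _ + X]big1 ?addn0 => [|x]; last first.
  rewrite andbT => /andP[ax _]; rewrite (eq_count (a2 := pred0)) ?count_pred0 //.
  by move=> w /=; rewrite tE touches_gt // leq_max ax orbT.
by apply: eq_bigr => x _; apply: eq_count => w; rewrite tE.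
Qed.

(** Once the maximum [a] is reached, the middle letters are free in [1..a] and
    the last letter only has to be at least [a]. *)
Lemma count_touches_top d a : 0 < a <= t -> K d a a = a ^ d * e a.
Proof.
move=> /andP[a0 at0]; elim: d => [|d IHd].
  rewrite count_touches0 mul1n (minn_idPl _) ?eqxx ?mul1n; last by lia.
  congr (_ * _ + _); rewrite (big_cat_nat (n := a)) //=; last by lia.
  rewrite big_nat_cond big1 => [|b]; last first.
    by rewrite andbT => /andP[_ ba]; apply/eqP; rewrite eqb0; apply/eqP; lia.
  rewrite (eq_big_nat _ _ (F2 := fun=> 1)) => [|b /andP[ab _]]; last first.
    by rewrite (minn_idPl ab) eqxx.
  by rewrite sum_nat_const_nat muln1 subSn.
rewrite count_touchesS // (eq_big_nat _ _ (F2 := fun=> a ^ d * e a)); last first.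
  by move=> x /andP[_ xa]; rewrite (maxn_idPl _) ?IHd.
by rewrite sum_nat_const_nat subn1 expnS mulnA.
Qed.

(** Solved for [K], this reads
    [(a-1)^d * c + (a^d - (a-1)^d) * e a]: the middle letters either stay below
    [a], and then the last letter is forced to be their maximum, or they reach
    [a].  The value does not depend on [M]; the case [M = d = 0] is excluded
    because the last letter would be forced to be 0. *)
Lemma count_touches d M a : M < a <= t -> 0 < M + d ->
  K d M a + a.-1 ^ d * e a = a.-1 ^ d * c + a ^ d * e a.
Proof.
case: a => [//|a] /andP[Ma at0]; elim: d M Ma => [|d IHd] M Ma Md.
  rewrite count_touches0 !mul1n; congr addn.
  rewrite (_ : M == _ = false) ?addn0; last by apply/eqP; lia.
  rewrite -[RHS]mul1n; congr muln.
  rewrite (bigD1_seq M) ?iota_uniq ?mem_index_iota //=; last by lia.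
  rewrite big1 => [|b /eqP bM].
    by rewrite addn0 (_ : _ == _) //; apply/eqP; lia.
  by apply/eqP; rewrite eqb0; apply/eqP; lia.
rewrite count_touchesS // big_nat_recr //= (maxn_idPr (ltnW Ma)).
rewrite (count_touches_top d a.+1); last by lia.
have -> : a ^ d.+1 * e a.+1 = \sum_(1 <= x < a.+1) a ^ d * e a.+1.
  by rewrite sum_nat_const_nat subn1 expnS mulnA.
rewrite addnAC -big_split /=.
rewrite (eq_big_nat _ _ (F2 := fun=> a ^ d * c + a.+1 ^ d * e a.+1)); last first.
  by move=> x /andP[x0 xa]; apply: IHd; lia.
rewrite sum_nat_const_nat subn1 /= !expnS.
by rewrite mulnDr -addnA mulnA; congr addn; rewrite !mulnA mulSn mulnDl addnC.
Qed.

(** Summation by parts: since [e a = e (a+1) + c], the terms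
    [(a^d - (a-1)^d) * e a] telescope up to a power sum, which adds to the
    identical power sum coming from the terms [(a-1)^d * c]; hence the
    factor 2. *)
Lemma sum_count_touches d u : 0 < d -> u <= t ->
  \sum_(1 <= a < u.+1) K d 0 a = u ^ d * e u + 2 * (\sum_(0 <= k < u) k ^ d) * c.
Proof.
move=> d0; elim: u => [|u IHu] ut.
  by rewrite !big_geq // exp0n.
rewrite [LHS]big_nat_recr; last by [].
rewrite [in RHS]big_nat_recr; last by [].
rewrite IHu; last exact: ltnW.
have := count_touches d 0 u.+1; rewrite ut add0n => /(_ isT d0) /=.
have -> : e u = e u.+1 + c by rewrite /e (_ : t - u = (t - u.+1).+1); lia.
by rewrite !mulnDr !mulnDl; lia.
Qed.

End Touching.

(** Here the letter at position [i] is the head of the word. *)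
Definition touching_growths (d r t : nat) : nat :=
  count (fun w => touches d 0 (nth 0 w 0) (behead w)) (growths (d + r.+1).+1 t).

(** The letters up to [t] are treated by [sum_count_touches]; the record letter
    [t + 1] is the case of [count_touches] in which [a] equals the maximum,
    now [t + 1]. *)
Lemma touching_growthsE d r t : 0 < d ->
  touching_growths d r t + t ^ d * size (growths r t.+2) =
  t ^ d * (size (growths r t) + size (growths r t.+1))
  + 2 * (\sum_(0 <= k < t) k ^ d) * size (growths r t)
  + t.+1 ^ d * (size (growths r t.+1) + size (growths r t.+2)).
Proof.
move=> d0; rewrite /touching_growths count_growthsS /=.
have := sum_count_touches r t d t d0 (leqnn t); rewrite subnn mul1n => ->.
have := count_touches r t.+1 d 0 t.+1; rewrite add0n => /(_ (leqnn _) d0).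
rewrite subnn mul1n /= !mulnDr.
by rewrite -[count [eta _] _]/(count (touches d 0 t.+1) _); lia.
Qed.

Lemma touching_growths0 d r : 0 < d ->
  touching_growths d r 0 = size (growths r.+2 0).
Proof.
move=> d0; have := touching_growthsE d r 0 d0.
by rewrite exp0n // big_geq // !size_growths /= /grow exp1n; lia.
Qed.

Lemma card_touching_RG (i d r : nat) :
  #|[set p in RG (i + d + r.+2) | (i.+1, i + d.+2) \in
      [predD weak_visible (word p) & strong_visible (word p)]]|
  = iter i grow (touching_growths d r) 0.
Proof.
pose Q w := touches d 0 (nth 0 w 0) (behead w).
have -> : iter i grow (touching_growths d r) 0 =
    #|[set p in RG (i + d + r.+2) | Q (drop i (word p))]|.
  rewrite (card_RG _ (Q \o drop i)) (_ : i + d + r.+2 = i + (d + r.+1).+1).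
    by rewrite (count_drop_growths _ _ _ Q).
  by lia.
apply: eq_card => p; rewrite inE [RHS]inE; congr andb.
by apply: weak_not_strong; rewrite size_map size_tuple; lia.
Qed.

Lemma card_RG_bell (n : nat) : #|RG n| = bell n.
Proof.
rewrite bellE -size_growths -count_predT -card_RG.
by apply: eq_card => p; rewrite inE andbT.
Qed.

Lemma bell_gt0 (n : nat) : 0 < bell n.
Proof.
rewrite bellE; suff gt0 t : 0 < iter n grow (fun=> 1) t by [].
by elim: n t => [//|n IHn] t; rewrite iterS addn_gt0 IHn orbT.
Qed.

(** * The series Theta *)

Local Open Scope ring_scope.

(** Writing [m = t + (m - t)] in [m^{n+1} / (m-t)!] and cancelling [m - t] in the
    factorial, where the term [m = t] vanishes, gives the recurrence of [grow]
    already for partial sums; the case [n = 0] is the exponential series shifted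
    by [t]. *)
Lemma Theta_partial_sum_cvg (R : realType) (n t : nat) :
  ((\sum_(t <= m < N) (m%:R ^+ n / ((m - t)`!)%:R : R))
    @[N --> \oo] --> (expR 1 * (size (growths n t))%:R : R))%classic.
Proof.
elim: n t => [|n IHn] t.
  rewrite /= mulr1 -(cvg_shiftn t).
  have -> : [sequence (\sum_(t <= m < N + t) (m%:R ^+ 0 / ((m - t)`!)%:R : R))]_N
          = series (exp_coeff (1 : R)).
    apply/funext => N /=; rewrite -{1}[t]add0n big_addn addnK.
    by apply: eq_bigr => k _; rewrite addnK expr0 /exp_coeff /= expr1n.
  exact: is_cvg_series_exp_coeff.
have -> : (fun N => \sum_(t <= m < N) (m%:R ^+ n.+1 / ((m - t)`!)%:R : R)) =
  (fun N => t%:R * (\sum_(t <= m < N) (m%:R ^+ n / ((m - t)`!)%:R))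
          + \sum_(t.+1 <= m < N) (m%:R ^+ n / ((m - t.+1)`!)%:R)).
  apply/funext => N; have [Nt|tN] := leqP N t.
    by rewrite !big_geq ?mulr0 ?addr0 //; apply: leqW.
  have -> : \sum_(t.+1 <= m < N) (m%:R ^+ n / ((m - t.+1)`!)%:R) =
    \sum_(t <= m < N) ((m - t)%:R * m%:R ^+ n / ((m - t)`!)%:R : R).
    rewrite [RHS]big_ltn // subnn !mul0r add0r.
    apply: eq_big_nat => m /andP[tm _]; rewrite -(subnSK tm) factS natrM invfM.
    by rewrite [_.+1%:R * _]mulrC mulrA mulfK // pnatr_eq0.
  rewrite mulr_sumr -big_split /=.
  apply: eq_big_nat => m /andP[tm _].
  by rewrite natrB // exprS mulrBl mulrBl !mulrA addrC subrK.
have -> : size (growths n.+1 t) =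
    (t * size (growths n t) + size (growths n t.+1))%N.
  by rewrite !size_growths.
rewrite natrD natrM mulrDr mulrCA.
by apply: cvgD => //; apply: cvgMl_tmp.
Qed.

Lemma ThetaE (R : realType) (n t : nat) :
  Theta R n t = (size (growths n t))%:R.
Proof.
rewrite /Theta (cvg_lim _ (Theta_partial_sum_cvg R n t)) //.
by rewrite mulKf // gt_eqF // expR_gt0.
Qed.

(** * The probability of being weakly but not strongly visible *)

Theorem theorem5 (R : realType) (n : nat) (hn : (3 <= n)%N) :
  (forall i j : nat, (2 <= i)%N -> (i < j)%N -> (j <= n)%N -> (i + 1 < j)%N ->
    (bell n)%:R *
      unif_prob R (RG n) (fun p =>
        (i, j) \in [predD weak_visible (word p) & strong_visible (word p)])
    = \sum_(1 <= t < i) (stirling2 (i - 1) t)%:R * Theta R (n - j) t *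
        (- t%:R ^+ (j - i) + t%:R ^+ (j - i - 1)
         + 2 * (Psi (j - i) (t - 1))%:R)
      + \sum_(1 <= t < i) (stirling2 (i - 1) t)%:R * Theta R (n - j + 1) t *
          t%:R ^+ (j - i - 1)
      - \sum_(1 <= t < i) (stirling2 (i - 1) t)%:R * Theta R (n - j) (t + 1) *
          (- ((t + 1)%:R * t%:R ^+ (j - i - 1))
           + t%:R * (t + 1)%:R ^+ (j - i - 1))
      + \sum_(1 <= t < i) (stirling2 (i - 1) t)%:R * Theta R (n - j + 1) (t + 1) *
          ((t + 1)%:R ^+ (j - i - 1) - t%:R ^+ (j - i - 1)))
  /\
  (forall i j : nat, i = 1%N -> (3 <= j)%N -> (j <= n)%N ->
    unif_prob R (RG n) (fun p =>
      (i, j) \in [predD weak_visible (word p) & strong_visible (word p)])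
    = (bell (n - j + i + 1))%:R / (bell n)%:R).
Proof.
split=> [i j i2 ij jn ij1|i j -> j3 jn].
(* The prefix before position [i] has length [i0 = i - 1]; [d] letters lie
   strictly between [i] and [j], and [r] letters come after [j]. *)
- have [i0 ei] : exists i0, i = i0.+1 by exists i.-1; lia.
  have [d ej] : exists d, j = (i0 + d.+2)%N by exists (j - i0 - 2)%N; lia.
  have [r en] : exists r, n = (i0 + d + r.+2)%N by exists (n - j)%N; lia.
  have d0 : (0 < d)%N by lia.
  have i00 : (0 < i0)%N by lia.
  rewrite /unif_prob card_RG_bell mulrCA divff ?mulr1; last first.
    by rewrite pnatr_eq0 -lt0n bell_gt0.
  rewrite {}ej {}ei {}en in hn i2 ij jn ij1 *.
  rewrite card_touching_RG -sum_stirling2 big_ltn // stirling2_0 // mul0n add0n.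
  rewrite (_ : i0 + d + r.+2 - _ = r)%N; last by lia.
  rewrite (_ : i0 + d.+2 - _ = d.+1)%N; last by lia.
  rewrite !subn1 /= natr_sum -sumrN -!big_split /=.
  apply: eq_big_nat => t /andP[t0 _].
  rewrite natrM !ThetaE !addn1 /Psi subn1 prednK //=.
  have := touching_growthsE d r t d0.
  have growE s : size (growths r.+1 s) =
      (s * size (growths r s) + size (growths r s.+1))%N.
    by rewrite !size_growths.
  rewrite !growE => /(congr1 (fun k => k%:R : R)).
  rewrite !(natrD, natrM, natrX) -[t.+1%:R]natr1 => TE.
  rewrite -[(touching_growths d r t)%:R]
    (addrK (t%:R ^+ d * (size (growths r t.+2))%:R)).
  by rewrite TE exprS; ring.
have [d ej] : exists d, j = (0 + d.+2)%N by exists (j - 2)%N; lia.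
have [r en] : exists r, n = (0 + d + r.+2)%N by exists (n - j)%N; lia.
rewrite /unif_prob card_RG_bell; congr (_%:R / _).
rewrite {}ej {}en in hn j3 jn *.
rewrite card_touching_RG /= touching_growths0; last by lia.
rewrite size_growths -bellE; congr bell; lia.
Qed.
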